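(* Let $R$ be a finite non-commutative ring and let $r \in R$. Then $$\mathrm{Pr}_r(R) = \frac{1}{|R|^2}\sum_{\substack{x\in R\\ r\in [x,R]}} |C_R(x)| = \frac{1}{|R|}\sum_{\substack{x\in R\\ r\in [x,R]}} \frac{1}{|[x,R]|}.$$
   Context: For a ring $R$ and $x,y\in R$, the commutator is $[x,y] := xy-yx$. For a finite ring $R$ and $r\in R$, $\mathrm{Pr}_r(R) := \frac{|\{(x,y)\in R\times R : [x,y]=r\}|}{|R\times R|}$. For $x\in R$, $[x,R]$ denotes the additive subgroup of $(R,+)$ generated by $\{[x,y] : y\in R\}$ (every element of it is of the form $[x,y]$ for some $y \in R$), and $C_R(x) := \{y\in R : xy=yx\}$ is the centralizer of $x$ in $R$. *)

(* Defs.v *)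
From HB Require Import structures.
From mathcomp Require Import all_boot all_order all_fingroup all_algebra.

Set Implicit Arguments.
Unset Strict Implicit.
Unset Printing Implicit Defensive.

Import GRing.Theory.
Local Open Scope ring_scope.

(* Rings are not assumed to have an identity element, and MathComp's ring
   structures all have one, so the multiplication is added to [finZmodType]
   here.  Finite rings with identity are covered by [rng_of_ring]. *)
HB.mixin Record Zmodule_isRng R of GRing.Zmodule R := {
  rmul : R -> R -> R;
  rmulA : associative rmul;
  rmulDl : left_distributive rmul +%R;
  rmulDr : right_distributive rmul +%R
}.

#[short(type="finRngType")]
HB.structure Definition FinRng :=
  {R of Zmodule_isRng R & FinRing.Zmodule R}.

(* Makes [<<A>>%g], for [A : {set R}], the subgroup of (R, +) generated by A,
   as finalg does for the other finite algebraic structures. *)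
HB.instance Definition _ (R : finRngType) := [finGroupMixin of R for +%R].

Definition rng_of_ring (R : finPzRingType) : finRngType :=
  HB.pack (FinRing.PzRing.sort R)
    (Zmodule_isRng.Build R (@mulrA R) (@mulrDl R) (@mulrDr R)).

Section Commutators.
Variable R : finRngType.
Implicit Types x y r : R.

Definition rng_comm x y : R := rmul x y - rmul y x.

Definition rng_commg x : {set R} :=
  <<[set rng_comm x y | y : R]>>%g.

Definition rng_centralizer x : {set R} := [set y | rmul x y == rmul y x].

Definition Pr r : rat :=
  #|[set p : R * R | rng_comm p.1 p.2 == r]|%:R / #|{: R * R}|%:R.

End Commutators.

(* Main.v *)
(* For each x, y |-> [x, y] is an endomorphism of (R, +) with kernel C_R(x)
   and image [x, R].  Its fibre over r is a coset of C_R(x) if r is in [x, R]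
   and is empty otherwise, and |R| = |[x, R]| |C_R(x)|. *)
Require Import Defs.
From mathcomp Require Import all_boot all_order all_fingroup all_algebra.

Lemma rng_commD (R : finRngType) (x : R) :
  {morph rng_comm x : y z / (y + z)%R}.
Proof.
by move=> y z; rewrite /rng_comm rmulDl rmulDr GRing.opprD GRing.addrACA.
Qed.

Lemma rng_commB (R : finRngType) (x : R) :
  {morph rng_comm x : y z / (y - z)%R}.
Proof.
move=> y z; apply: (GRing.addIr (rng_comm x z)).
by rewrite -rng_commD !GRing.subrK.
Qed.

Lemma rng_comm_eq0 (R : finRngType) (x y : R) :
  (rng_comm x y == 0)%R = (y \in rng_centralizer x).
Proof. by rewrite inE GRing.subr_eq0. Qed.

Lemma rng_commM (R : finRngType) (x : R) :
  {in [set: R] &, {morph rng_comm x : y z / (y * z)%g}}.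
Proof. by move=> y z _ _; apply: rng_commD. Qed.

(** Packaged as a group morphism so that its image carries a canonical group structure. *)
Definition rng_comm_morphism (R : finRngType) (x : R) :=
  Morphism (rng_commM R x).

(** The image of a morphism is already a subgroup, so generating adds no element. *)
Lemma rng_commgE (R : finRngType) (x : R) :
  rng_commg x = [set rng_comm x y | y : R].
Proof.
have E : [set rng_comm x y | y : R] = (rng_comm_morphism R x @* [set: R])%g.
  rewrite morphimEdom; apply/setP=> z.
  by apply/imsetP/imsetP => -[y _ ->]; exists y.
by rewrite /rng_commg E genGid.
Qed.

Lemma card_rng_comm_fibre (R : finRngType) (r x : R) :
  #|[set y | rng_comm x y == r]|
    = if r \in rng_commg x then #|rng_centralizer x| else 0.
Proof.
rewrite rng_commgE; case: imsetP => [[y0 _ ->] | nr]; last first.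
  by apply: eq_card0 => y; rewrite inE; apply/eqP => e; case: nr; exists y.
(* The fibre over [[x, y0]] is the translate of [C_R(x)] by [y0], and translation is injective. *)
rewrite -[RHS](card_imset _ (GRing.addIr y0)); apply: eq_card => y.
rewrite in_set -GRing.subr_eq0 -rng_commB rng_comm_eq0.
apply/idP/imsetP => [yC | [z zC ->]]; last by rewrite GRing.addrK.
by exists (y - y0)%R; rewrite ?GRing.subrK.
Qed.

(** Partition [R] into the fibres of [rng_comm x]: there is one for each element of [[x, R]], and
    each has [|C_R(x)|] elements. *)
Lemma card_rng_commg_centralizer (R : finRngType) (x : R) :
  (#|rng_commg x| * #|rng_centralizer x|)%N = #|R|.
Proof.
rewrite -[RHS]sum1_card.
rewrite (partition_big (rng_comm x) (mem (rng_commg x))) /=; last first.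
  by move=> y _; rewrite rng_commgE imset_f.
rewrite -sum_nat_const; apply: eq_bigr => r rx.
by rewrite sum1dep_card card_rng_comm_fibre rx.
Qed.

(** Sorting the pairs by first component [x] leaves one fibre count for each [x]. *)
Lemma card_rng_comm_pairs (R : finRngType) (r : R) :
  #|[set p : R * R | rng_comm p.1 p.2 == r]|
    = \sum_(x : R | r \in rng_commg x) #|rng_centralizer x|.
Proof.
rewrite -sum1dep_card -(pair_big_dep predT (fun x y => rng_comm x y == r)
  (fun _ _ => 1)) /= [RHS]big_mkcond /=.
by apply: eq_bigr => x _; rewrite sum1dep_card card_rng_comm_fibre.
Qed.

Theorem theorem2p3 (R : finRngType) (r : R) :
  ~ commutative (@rmul R) ->
  Pr r = (1 / #|R|%:R ^+ 2
           * \sum_(x : R | r \in rng_commg x) #|rng_centralizer x|%:R)%R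
  /\
  (1 / #|R|%:R ^+ 2
     * \sum_(x : R | r \in rng_commg x) #|rng_centralizer x|%:R
   = 1 / #|R|%:R
     * \sum_(x : R | r \in rng_commg x)
         (1 / #|rng_commg x|%:R) :> rat)%R.
Proof.
move=> _; split.
  rewrite /Pr card_rng_comm_pairs card_prod GRing.natrM GRing.natr_sum.
  by rewrite GRing.mul1r GRing.mulrC GRing.expr2.
(* With one factor [1 / |R|] cancelled, it remains to show [|C_R(x)| / |R| = 1 / |[x, R]|] term by
   term. *)
rewrite !GRing.mul1r GRing.expr2 GRing.invfM -GRing.mulrA; congr (_ * _)%R.
rewrite GRing.mulr_sumr; apply: eq_bigr => x _.
(* Since [x] commutes with itself, [C_R(x)] is nonempty and its order can be cancelled. *)
have C0 : (#|rng_centralizer x|%:R != 0 :> rat)%R.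
  rewrite Num.Theory.pnatr_eq0 -lt0n; apply/card_gt0P.
  by exists x; rewrite inE.
rewrite -(card_rng_commg_centralizer R x) GRing.natrM GRing.invfM.
by rewrite GRing.mulfVK // GRing.mul1r.
Qed.
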